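(* Let $A,B\in\mathbb{R}^{n\times n}$ be symmetric positive definite, let $0<\lambda_1<\lambda_2\le\dots\le\lambda_n$ be the eigenvalues of $A$, let $u_*$ be an eigenvector of $A$ associated with $\lambda_1$, and let $x_*:=B^{1/2}u_*/\|B^{1/2}u_*\|$. The function $f(x)=-\dfrac{x^{\mathsf T}B^{-1}x}{x^{\mathsf T}B^{-1/2}AB^{-1/2}x}$ satisfies $$f(x)-f_*\le\frac{1}{a(x)}\langle\operatorname{grad}f(x),-\log_x(x_* )\rangle-\frac{\mu(x)}{2}\operatorname{dist}^2(x,x_* )$$ for every $x\in\mathbb{S}^{n-1}$ satisfying $\operatorname{dist}(x,x_* )<\varphi$, where $$\mu(x)=\frac{8\nu_{\min}(\lambda_1^{-1}-\lambda_2^{-1})\|u_*\|_B}{\pi^2\|A^{1/2}B^{-1/2}x\|\,\|u_*\|_A},\qquad a(x)=\frac{\lambda_1\|u_*\|_{B^{-1}}^2\bigl(\cos(\operatorname{dist}(x,x_* ))-\cos\varphi\bigr)}{\|A^{1/2}B^{-1/2}x\|^2\|u_*\|^2}.$$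
   Context: $\langle\cdot,\cdot\rangle$ and $\|\cdot\|$ are the Euclidean inner product and norm, and $\|v\|_C:=\sqrt{v^{\mathsf T}Cv}$ for a symmetric positive definite matrix $C$. $\mathbb{S}^{n-1}$ is the unit sphere in $\mathbb{R}^n$ with the restricted Euclidean metric. $f_*:=f(x_* )=-1/\lambda_1$ is the minimum of $f$ on $\mathbb{S}^{n-1}$. $\operatorname{grad}f(x)=(I-xx^{\mathsf T})\nabla f(x)$ is the Riemannian gradient. $\operatorname{dist}(x,x_* ):=\arccos(x^{\mathsf T}x_* )$. The logarithmic map is $\log_x(x_* )=\operatorname{dist}(x,x_* )\,\dfrac{P_xx_*}{\|P_xx_*\|}$ with $P_x:=I-xx^{\mathsf T}$ (and $\log_x(x_* )=0$ if $x=x_*$). $\nu_{\min},\nu_{\max}$ are constants with $0<\nu_{\min}\le\nu_{\max}$ and $\nu_{\min}\,x^{\mathsf T}Bx\le x^{\mathsf T}Ax\le\nu_{\max}\,x^{\mathsf T}Bx$ for all $x\in\mathbb{R}^n$. The angle of distortion is $\varphi:=\arcsin\dfrac{\|u_*\|^2}{\|u_*\|_B\|u_*\|_{B^{-1}}}\in(0,\pi/2]$. *)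

(* Defs.v *)
From HB Require Import structures.
From mathcomp Require Import all_boot all_order all_algebra.
From mathcomp Require Import all_classical all_reals all_analysis.
Set Implicit Arguments.
Unset Strict Implicit.
Unset Printing Implicit Defensive.
Import Order.TTheory GRing.Theory Num.Theory.
Import numFieldNormedType.Exports.
Local Open Scope classical_set_scope.
Local Open Scope ring_scope.

Definition inner (R : realType) (n : nat) (u v : 'cV[R]_n) : R :=
  (u^T *m v) 0 0.

(* The library norm `|v| on matrices is the sup norm, hence this one. *)
Definition enorm (R : realType) (n : nat) (v : 'cV[R]_n) : R :=
  Num.sqrt (inner v v).

Definition normC (R : realType) (n : nat) (C : 'M[R]_n) (v : 'cV[R]_n) : R :=
  Num.sqrt (inner v (C *m v)).

Definition spd (R : realType) (n : nat) (C : 'M[R]_n) : Prop :=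
  C^T = C /\ forall v : 'cV[R]_n, v != 0 -> 0 < inner v (C *m v).

(* C^{1/2}: the symmetric positive definite S with S S = C, which exists and
   is unique for C symmetric positive definite (junk value 0 otherwise). *)
Definition mxsqrt (R : realType) (n : nat) (C : 'M[R]_n) : 'M[R]_n :=
  xget 0 [set S : 'M[R]_n | spd S /\ S *m S = C].

Definition mxisqrt (R : realType) (n : nat) (C : 'M[R]_n) : 'M[R]_n :=
  invmx (mxsqrt C).

(* As roots of the characteristic polynomial, lam lists each eigenvalue with
   its multiplicity. *)
Definition eigenvalues (R : realType) (n : nat) (A : 'M[R]_n)
    (lam : 'I_n -> R) : Prop :=
  char_poly A = \prod_(i < n) ('X - (lam i)%:P).

Definition sphere (R : realType) (n : nat) : set 'cV[R]_n :=
  [set x | enorm x = 1].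

Definition sphdist (R : realType) (n : nat) (x y : 'cV[R]_n) : R :=
  acos (inner x y).

Definition tproj (R : realType) (n : nat) (x : 'cV[R]_n) : 'M[R]_n :=
  1%:M - x *m x^T.

(* The logarithm is undefined at y = - x; the formula gives 0 there. *)
Definition sphlog (R : realType) (n : nat) (x y : 'cV[R]_n) : 'cV[R]_n :=
  if x == y then 0
  else (sphdist x y / enorm (tproj x *m y)) *: (tproj x *m y).

Definition nabla (R : realType) (n : nat) (f : 'cV[R]_n -> R)
    (x : 'cV[R]_n) : 'cV[R]_n :=
  \col_(i < n) 'D_(delta_mx i 0) f x.

Definition rgrad (R : realType) (n : nat) (f : 'cV[R]_n -> R)
    (x : 'cV[R]_n) : 'cV[R]_n :=
  tproj x *m nabla f x.

(* Defined by its formula on all of R^n, so that its Euclidean gradient makes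
   sense at points of the sphere. *)
Definition cost (R : realType) (n : nat) (A B : 'M[R]_n)
    (x : 'cV[R]_n) : R :=
  - (inner x (invmx B *m x)
     / inner x (mxisqrt B *m A *m mxisqrt B *m x)).

Definition xstar (R : realType) (n : nat) (B : 'M[R]_n)
    (u : 'cV[R]_n) : 'cV[R]_n :=
  (enorm (mxsqrt B *m u))^-1 *: (mxsqrt B *m u).

Definition distortion (R : realType) (n : nat) (B : 'M[R]_n)
    (u : 'cV[R]_n) : R :=
  asin (enorm u ^+ 2 / (normC B u * normC (invmx B) u)).

Definition mu_coef (R : realType) (n : nat) (A B : 'M[R]_n)
    (numin lam1 lam2 : R) (u x : 'cV[R]_n) : R :=
  (8 * numin * (lam1^-1 - lam2^-1) * normC B u)
  / (pi ^+ 2 * enorm (mxsqrt A *m mxisqrt B *m x) * normC A u).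

Definition a_coef (R : realType) (n : nat) (A B : 'M[R]_n)
    (lam1 : R) (u x : 'cV[R]_n) : R :=
  (lam1 * normC (invmx B) u ^+ 2
    * (cos (sphdist x (xstar B u)) - cos (distortion B u)))
  / (enorm (mxsqrt A *m mxisqrt B *m x) ^+ 2 * enorm u ^+ 2).

(* Main.v *)
(* Write x = B^{1/2} y, q = y^T A y and d = dist(x, x_* ). Since u_* is an
   eigenvector of A, the derivative of f along -log_x(x_* ) is
   (d / sin d) (2 lambda_1 / q) (u_*^T y / |u_*|_B) (f(x) - f_* ).
   The factor u_*^T y is |u_*|_{B^{-1}} times the cosine of the angle between x
   and B^{-1/2} u_*, which makes the angle pi/2 - phi with x_*; the spherical
   triangle inequality bounds this cosine below by sin(phi - d), and
   sin phi sin(phi - d) >= cos d - cos phi, so that a(x)^{-1} times the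
   derivative is at least 2 (f(x) - f_* ).
   Conversely f(x) - f_* >= (1/lambda_1 - 1/lambda_2) (1 - cos theta), where
   theta is the angle of y and u_* in the A-inner product; nu_min B <= A
   compares 1 - cos theta with 1 - cos d >= 4 d^2 / pi^2, and this gives
   f(x) - f_* >= mu(x) d^2 / 2. *)
From mathcomp Require Import all_boot all_order all_algebra.
From mathcomp Require Import fingroup perm spectral complex ring lra.
(* After fingroup, whose [normC] would shadow the norm of Defs. *)
Require Import Defs.
From mathcomp Require Import all_classical all_reals all_analysis.
Import Order.TTheory GRing.Theory Num.Theory numFieldNormedType.Exports.
Local Open Scope ring_scope.

(** * Real symmetric matrices *)

(** Over the complex extension [A] is hermitian, hence unitarily diagonalizable with real diagonal.
    A diagonal entry is then a root of the characteristic polynomial that lies in [R], so it has an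
    eigenvector over [R] as well. *)
Lemma symmetric_eigenvector (R : rcfType) (n : nat) (A : 'M[R]_n.+1) :
  A^T = A -> exists a : R, exists2 v : 'rV_n.+1, v != 0 & v *m A = a *: v.
Proof.
move=> symA; pose AC := map_mx (real_complex R) A.
have hermA : AC \is hermsymmx.
  apply: realsym_hermsym.
    apply/is_hermitianmxP.
    by rewrite expr0 scale1r map_mx_id // /AC map_trmx symA.
  by apply/mxOverP => i j; rewrite mxE complex_real.
have /mxOverP/(_ 0 0) := hermitian_spectral_diag_real hermA.
have /hermitian_normalmx/orthomx_spectralP := hermA.
set P := spectralmx AC; set D := spectral_diag AC => defA realD.
have unitP : P \in unitmx by apply: spectral_unit.
have PA : P *m AC = diag_mx D *m P by rewrite {1}defA -!mulmxA mulKVmx.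
have eigD : eigenvalue AC (D 0 0).
  apply/eigenvalueP; exists (row 0 P).
    by rewrite -row_mul PA row_mul row_diag_mx -scalemxAl -rowE.
  apply: contraTneq unitP => P0; rewrite unitmxE unitfE negbK.
  rewrite (expand_det_row _ 0) big1 // => j _.
  by move/rowP/(_ j): P0; rewrite !mxE => ->; rewrite mul0r.
have [a defa] : exists a : R, D 0 0 = real_complex R a.
  by exists (complex.Re (D 0 0)); rewrite RRe_real.
exists a; move: eigD; rewrite eigenvalue_root_char defa -map_char_poly fmorph_root.
by rewrite -eigenvalue_root_char => /eigenvalueP[v vA v0]; exists v.
Qed.

Lemma row_sqnorm_gt0 (R : realDomainType) (n : nat) (v : 'rV[R]_n) :
  v != 0 -> 0 < (v *m v^T) 0 0.
Proof.
move=> /rV0Pn[j vj]; rewrite mxE (bigD1 j) //= mxE ltr_pwDl //.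
  by rewrite -expr2 exprn_even_gt0.
by apply: sumr_ge0 => i _; rewrite mxE -expr2 sqr_ge0.
Qed.

(* Householder reflection exchanging the first basis vector and v. *)
Lemma orthonormal_completion (R : rcfType) (n : nat) (v : 'rV[R]_n.+1) :
  v *m v^T = 1%:M ->
  exists2 H : 'M[R]_n.+1, H *m H^T = 1%:M & row 0 H = v.
Proof.
move=> vv; pose e : 'rV[R]_n.+1 := delta_mx 0 0; pose w := e - v.
have ee : e *m e^T = 1%:M.
  by rewrite trmx_delta mul_delta_mx; apply/matrixP=> i j; rewrite !mxE !ord1.
have row0 H : row 0 H = e *m H by rewrite rowE.
have [w0|w0] := eqVneq w 0.
  exists 1%:M; first by rewrite trmx1 mulmx1.
  by rewrite row0 mulmx1; apply/eqP; rewrite -subr_eq0 -/w w0.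
have [b defb] : exists b, e *m v^T = b%:M.
  by exists ((e *m v^T) 0 0); rewrite -mx11_scalar.
have ve : v *m e^T = b%:M by rewrite -[LHS]trmxK trmx_mul trmxK defb tr_scalar_mx.
have ew : e *m w^T = (1 - b)%:M by rewrite linearB /= mulmxBr ee defb -raddfB.
have ww : w *m w^T = (2 * (1 - b))%:M.
  rewrite {1}/w mulmxBl ew linearB /= mulmxBr vv ve -!raddfB.
  by congr _%:M; rewrite mulr_natl mulr2n opprB.
have b1 : 1 - b != 0.
  apply: contraTneq (row_sqnorm_gt0 _ _ _ w0) => b1.
  by rewrite ww b1 mulr0 mxE mul0rn ltxx.
pose T := w^T *m w.
have symT : T^T = T by rewrite trmx_mul trmxK.
have TT : T *m T = (2 * (1 - b)) *: T.
  by rewrite mulmxA -(mulmxA w^T) ww mul_mx_scalar scalemxAl.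
(* Since [w] has squared norm [2 * (1 - b)], the coefficient [(1 - b)^-1] is the 2 / |w|^2 of the
   reflection along [w]. *)
exists (1%:M - (1 - b)^-1 *: T).
  rewrite [(_ - _)^T]linearB /= trmx1 [(_ *: T)^T]linearZ /= symT.
  rewrite mulmxBr mulmx1 mulmxBl mul1mx.
  rewrite -scalemxAl -scalemxAr TT.
  by apply/matrixP=> i j; rewrite !mxE; field.
rewrite row0 mulmxBr mulmx1 -scalemxAr mulmxA ew mul_scalar_mx scalerA mulVf //.
by rewrite scale1r /w opprB addrC subrK.
Qed.

(** Induction by deflation: in an orthonormal basis starting with a unit eigenvector, the first row
    of the matrix is [a] times the first basis vector, symmetry clears the first column too, and the
    remaining block is symmetric of smaller size. *)
Lemma symmetric_spectral (R : rcfType) (n : nat) (A : 'M[R]_n) :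
  A^T = A ->
  exists P : 'M[R]_n, exists2 d : 'rV_n,
    P *m P^T = 1%:M & P *m A *m P^T = diag_mx d.
Proof.
elim: n A => [|n IHn] A symA.
  by exists 1%:M, 0; apply/matrixP => -[].
have [a [v0 v0_neq0 v0A]] := symmetric_eigenvector _ _ _ symA.
have v0v0 := row_sqnorm_gt0 _ _ _ v0_neq0.
set s := (v0 *m v0^T) 0 0 in v0v0.
pose v := (Num.sqrt s)^-1 *: v0.
have vv : v *m v^T = 1%:M.
  rewrite linearZ /= -scalemxAl -scalemxAr scalerA [v0 *m _]mx11_scalar -/s.
  by rewrite scale_scalar_mx -expr2 exprVn sqr_sqrtr ?ltW // mulVf ?lt0r_neq0.
have vA : v *m A = a *: v by rewrite -scalemxAl v0A !scalerA mulrC.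
have [H HH rowH] := orthonormal_completion _ _ _ vv.
pose M : 'M[R]_(1 + n) := H *m A *m H^T.
have symM : M^T = M by rewrite !trmx_mul trmxK symA mulmxA.
have rowM : row 0 M = a *: delta_mx 0 0.
  by rewrite !row_mul rowH vA -scalemxAl -rowH -row_mul HH row1.
have [P' [d' P'P' P'M]] : exists P : 'M[R]_n, exists2 d : 'rV_n,
    P *m P^T = 1%:M & P *m (drsubmx M) *m P^T = diag_mx d.
  by apply: IHn; rewrite trmx_drsub symM.
have defM : M = block_mx a%:M 0 0 (drsubmx M).
  have urM : ursubmx M = 0.
    apply/matrixP => i j; move/rowP/(_ (rshift 1 j)): rowM.
    by rewrite !mxE ord1 /= mulr0 lshift0.
  rewrite -{1}[M]submxK urM.
  have -> : dlsubmx M = 0 by rewrite -[dlsubmx M]trmxK trmx_dlsub symM urM trmx0.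
  congr block_mx; apply/matrixP => i j; move/rowP/(_ 0): rowM.
  by rewrite !mxE !ord1 /= mulr1 mulr1n lshift0.
pose Q : 'M[R]_(1 + n) := block_mx 1%:M 0 0 P'.
have QT : Q^T = block_mx 1%:M 0 0 P'^T by rewrite tr_block_mx !trmx0 trmx1.
have QQ : Q *m Q^T = 1%:M.
  rewrite QT mulmx_block !mulmx0 !mul0mx !mulmx1 !addr0 add0r P'P'.
  by rewrite scalar_mx_block.
have QMQ : Q *m M *m Q^T = diag_mx (row_mx a%:M d').
  rewrite defM QT !mulmx_block !mulmx0 !mul0mx !mulmx1 !mul1mx !addr0 !add0r.
  rewrite mul0mx P'M diag_mx_row; congr block_mx.
  by apply/matrixP => i j; rewrite !mxE !ord1 /= mulr1n.
exists (Q *m H), (row_mx a%:M d').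
  by rewrite trmx_mul mulmxA -(mulmxA Q) HH mulmx1 QQ.
by rewrite trmx_mul -QMQ /M !mulmxA.
Qed.

Lemma char_poly_orthogonal_conj (R : comNzRingType) (n : nat) (A P : 'M[R]_n) :
  P *m P^T = 1%:M -> char_poly (P *m A *m P^T) = char_poly A.
Proof.
move=> PP; pose C := map_mx (@polyC R) P.
have CC : C *m C^T = 1%:M by rewrite map_trmx -map_mxM PP map_mx1.
have -> : char_poly (P *m A *m P^T) = \det (C *m char_poly_mx A *m C^T).
  rewrite /char_poly /char_poly_mx mulmxBr mulmxBl !map_mxM -map_trmx.
  by rewrite scalar_mxC -[_%:M *m C *m _]mulmxA CC mulmx1.
by rewrite !det_mulmx mulrAC -det_mulmx CC det1 mul1r.
Qed.

(** The diagonal supplied by [symmetric_spectral] and [lam] are root lists of the same split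
    polynomial, so they differ by a permutation; permuting the rows of [P] puts the eigenvalues in
    the prescribed order. *)
Lemma symmetric_diagonalization (R : rcfType) (n : nat) (A : 'M[R]_n)
    (lam : 'I_n -> R) :
  A^T = A -> char_poly A = \prod_(i < n) ('X - (lam i)%:P) ->
  exists2 P : 'M[R]_n, P *m P^T = 1%:M & P *m A *m P^T = diag_mx (\row_i lam i).
Proof.
move=> symA; have [P [d PP PA]] := symmetric_spectral _ _ _ symA.
rewrite -(char_poly_orthogonal_conj _ _ _ _ PP) PA char_poly_trig; last first.
  exact: diag_mx_is_trig.
under eq_bigr do rewrite mxE eqxx mulr1n.
move=> eq_lam.
have prodE (f : 'I_n -> R) :
    \prod_(a <- [tuple f i | i < n]) ('X - a%:P) = \prod_(i < n) ('X - (f i)%:P).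
  by rewrite big_tuple; apply: eq_bigr => i _; rewrite tnth_mktuple.
have /tuple_permP[s /val_inj lam_d] :
    perm_eq [tuple lam i | i < n] [tuple d 0 i | i < n].
  by apply: prod_XsubC_eq; rewrite !prodE.
have lamE i : lam i = d 0 (s i).
  by move/(congr1 (fun t => tnth t i)): lam_d; rewrite !tnth_mktuple.
exists (row_perm s P).
  rewrite row_permE trmx_mul mulmxA -(mulmxA (perm_mx s)) PP mulmx1.
  by rewrite tr_perm_mx -perm_mxM mulgV perm_mx1.
rewrite row_permE trmx_mul mulmxA -!(mulmxA (perm_mx s)) PA.
rewrite tr_perm_mx -col_permE -row_permE; apply/matrixP => i j.
by rewrite !mxE (inj_eq perm_inj) lamE.
Qed.

(** * The Euclidean inner product *)

Section Inner.
Context {R : realType} {n : nat}.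
Implicit Types (u v w : 'cV[R]_n) (C : 'M[R]_n).

Lemma innerE u v : inner u v = \sum_i u i 0 * v i 0.
Proof. by rewrite /inner mxE; apply: eq_bigr => i _; rewrite mxE. Qed.

Lemma innerC u v : inner u v = inner v u.
Proof. by rewrite !innerE; apply: eq_bigr => i _; rewrite mulrC. Qed.

Lemma innerDr u v w : inner u (v + w) = inner u v + inner u w.
Proof. by rewrite /inner mulmxDr mxE. Qed.

Lemma innerZr u (a : R) v : inner u (a *: v) = a * inner u v.
Proof. by rewrite /inner -scalemxAr mxE. Qed.

Lemma innerv0 u : inner u 0 = 0.
Proof. by rewrite /inner mulmx0 mxE. Qed.

Lemma innerNr u v : inner u (- v) = - inner u v.
Proof. by rewrite -scaleN1r innerZr mulN1r. Qed.

Lemma innerBr u v w : inner u (v - w) = inner u v - inner u w.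
Proof. by rewrite innerDr innerNr. Qed.

Lemma innerDl u v w : inner (u + v) w = inner u w + inner v w.
Proof. by rewrite innerC innerDr !(innerC w). Qed.

Lemma innerZl (a : R) u v : inner (a *: u) v = a * inner u v.
Proof. by rewrite innerC innerZr innerC. Qed.

Lemma innerBl u v w : inner (u - v) w = inner u w - inner v w.
Proof. by rewrite innerC innerBr !(innerC w). Qed.

Lemma inner_mull C u v : inner (C *m u) v = inner u (C^T *m v).
Proof. by rewrite /inner trmx_mul mulmxA. Qed.

Lemma inner_symm C u v : C^T = C -> inner u (C *m v) = inner (C *m u) v.
Proof. by move=> symC; rewrite inner_mull symC. Qed.

Lemma inner_delta u i : inner (delta_mx i 0) u = u i 0.
Proof.
rewrite innerE (bigD1 i) //= big1 ?addr0 ?mxE ?eqxx ?mul1r // => j /negPf ji.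
by rewrite mxE ji mul0r.
Qed.

Lemma inner_ge0 u : 0 <= inner u u.
Proof. by rewrite innerE; apply: sumr_ge0 => i _; rewrite -expr2 sqr_ge0. Qed.

Lemma inner_gt0 u : u != 0 -> 0 < inner u u.
Proof.
move=> u0; have : u^T != 0.
  by apply: contraNneq u0 => uT0; rewrite -[u]trmxK uT0 trmx0.
by move/row_sqnorm_gt0; rewrite trmxK.
Qed.

Lemma sqr_enorm u : enorm u ^+ 2 = inner u u.
Proof. by rewrite sqr_sqrtr // inner_ge0. Qed.

Lemma inner_cauchy_schwarz u v : inner u v ^+ 2 <= inner u u * inner v v.
Proof.
have [->|v0] := eqVneq v 0; first by rewrite !innerv0 expr0n mulr0.
have vv := inner_gt0 _ v0.
have := inner_ge0 (inner v v *: u - inner u v *: v).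
rewrite innerBl !innerBr !innerZl !innerZr (innerC v u) => h.
rewrite -(ler_pM2l vv) -subr_ge0; apply: le_trans h _.
by rewrite le_eqVlt; apply/predU1P; left; ring.
Qed.

Lemma spd_unit C : spd C -> C \in unitmx.
Proof.
move=> [symC posC]; rewrite -unitmx_tr -row_free_unit -kermx_eq0.
apply/eqP/row_matrixP => i; rewrite row0; apply/eqP; apply: contraT => k0.
have : row i (kermx C^T) *m C^T = 0 by apply/sub_kermxP; rewrite row_sub.
move/(congr1 trmx); rewrite trmx_mul trmxK trmx0 => Ck.
have /posC : (row i (kermx C^T))^T != 0.
  by apply: contraNneq k0 => k0; rewrite -[row _ _]trmxK k0 trmx0.
by rewrite Ck /inner mulmx0 mxE ltxx.
Qed.

Lemma spd_sqrt C : spd C -> exists S : 'M[R]_n, spd S /\ S *m S = C.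
Proof.
move=> [symC posC]; have [P [d PP PC]] := symmetric_spectral _ _ _ symC.
have PP' := mulmx1C PP.
have defC : C = P^T *m diag_mx d *m P.
  by rewrite -PC !mulmxA PP' mul1mx -mulmxA PP' mulmx1.
have d0 i : 0 < d 0 i.
  (* Each eigenvalue is the value of the quadratic form at its unit eigenvector, hence positive. *)
  have <- : inner (P^T *m delta_mx i 0) (C *m (P^T *m delta_mx i 0)) = d 0 i.
    rewrite inner_mull trmxK !mulmxA PC inner_delta -colE !mxE.
    by rewrite eqxx mulr1n.
  apply: posC; apply/eqP => /(congr1 (mulmx P)); rewrite mulmxA PP mul1mx mulmx0.
  by move/matrixP/(_ i 0)/eqP; rewrite !mxE !eqxx oner_eq0.
pose e := \row_i Num.sqrt (d 0 i).
exists (P^T *m diag_mx e *m P); split; last first.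
  rewrite !mulmxA -(mulmxA _ P) PP mulmx1 -(mulmxA P^T) mulmx_diag defC.
  congr (_ *m diag_mx _ *m _); apply/rowP => i.
  by rewrite !mxE -expr2 sqr_sqrtr ?ltW.
split; first by rewrite !trmx_mul trmxK tr_diag_mx mulmxA.
move=> v v0; rewrite -!mulmxA -(inner_mull P).
set w := P *m v; have /cV0Pn[i wi] : w != 0.
  by apply: contraNneq v0 => w0; rewrite -[v]mul1mx -PP' -mulmxA -/w w0 mulmx0.
have term j : w j 0 * (diag_mx e *m w) j 0 = Num.sqrt (d 0 j) * w j 0 ^+ 2.
  by rewrite mul_diag_mx !mxE; ring.
rewrite innerE (bigD1 i) //= term ltr_pwDl //.
  by rewrite mulr_gt0 ?sqrtr_gt0 // exprn_even_gt0.
by apply: sumr_ge0 => j _; rewrite term mulr_ge0 ?sqrtr_ge0 ?sqr_ge0.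
Qed.

Lemma mxsqrtP C : spd C -> spd (mxsqrt C) /\ mxsqrt C *m mxsqrt C = C.
Proof.
by move=> /spd_sqrt[S hS]; rewrite /mxsqrt; case: xgetP => [T _ //|/(_ S)].
Qed.

End Inner.

(** * Trigonometric estimates *)

(** Concavity of sine, free of division: the mean slopes on [0, t] and [t, a] are values of cosine
    at two ordered points, and cosine decreases on [0, pi]. *)
Lemma sin_chord (R : realType) (t a : R) :
  0 <= t -> t <= a -> a <= pi -> t * sin a <= a * sin t.
Proof.
rewrite le_eqVlt => /predU1P[<-|t0]; first by rewrite mul0r sin0 mulr0.
rewrite le_eqVlt => /predU1P[->//|ta] api.
have cont (x y : R) : {within `[x, y], continuous (@sin R)}%classic.
  by apply: continuous_subspaceT => z; apply: continuous_sin.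
have dsin (x y z : R) : z \in `]x, y[ -> is_derive z 1 sin (cos z).
  by move=> _; apply: is_derive_sin.
have [c1] := MVT t0 (dsin 0 t) (cont 0 t).
rewrite in_itv /= sin0 !subr0 => /andP[c10 c1t] sint.
have [c2] := MVT ta (dsin t a) (cont t a).
rewrite in_itv /= => /andP[c2t c2a] sina.
have cc : cos c2 <= cos c1.
  by rewrite ltW // ltr_cos ?in_itv /= ?ltW //=; lra.
have : t * (sin a - sin t) <= (a - t) * sin t.
  rewrite sina sint [leRHS]mulrCA mulrA [t * _]mulrC -mulrA [t * _]mulrC.
  by rewrite ler_wpM2r // mulr_ge0; lra.
lra.
Qed.

Lemma sin_le_id (R : realType) (d : R) : 0 < d -> sin d <= d.
Proof.
move=> d0.
have dsin (c : R) : c \in `]0, d[ -> is_derive c 1 sin (cos c).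
  by move=> _; apply: is_derive_sin.
have [|c _] := MVT d0 dsin.
  by apply: continuous_subspaceT => c; apply: continuous_sin.
by rewrite sin0 !subr0 => ->; rewrite ler_piMl ?cos_le1 // ltW.
Qed.

(** Write 1 - cos d = 2 sin^2 (d / 2) and compare sine with its chord on [0, pi / 4], where sin^2
    (pi / 4) = 1 / 2. The constant makes the bound an equality at d = pi / 2. *)
Lemma cos_quadratic_bound (R : realType) (d : R) :
  0 <= d -> d <= pi / 2 -> 4 / pi ^+ 2 * d ^+ 2 <= 1 - cos d.
Proof.
move=> d0 dpi; have pi0 := @pi_gt0 R.
have cos_half (x : R) : 1 - cos x = 2 * sin (x / 2) ^+ 2.
  by rewrite {1}(splitr x) cosD sin2cos2 -!expr2 sin2cos2; ring.
have sin4 : sin (pi / 2 / 2) ^+ 2 = 2^-1 :> R.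
  by have := cos_half (pi / 2); rewrite cos_pihalf; lra.
have s4 : 0 <= sin (pi / 2 / 2) :> R by apply: sin_ge0_pi; lra.
have := sin_chord _ (d / 2) (pi / 2 / 2).
move=> /(_ ltac:(lra) ltac:(lra) ltac:(lra)).
rewrite -(ler_pXn2r (ltn0Sn 1)) ?nnegrE; last 2 first.
- by rewrite mulr_ge0 //; lra.
- by rewrite mulr_ge0 ?sin_ge0_pi //; lra.
rewrite !exprMn sin4 cos_half.
set p := pi ^+ 2; set s := sin _ ^+ 2; set e := d ^+ 2 => h.
have p0 : 0 < p by rewrite exprn_gt0.
rewrite mulrAC ler_pdivrMr //; lra.
Qed.

(** Expand cos d = cos (phi - (phi - d)); the sign of [cos phi] allows cos (phi - d) to be replaced
    by 1. *)
Lemma cos_sub_le_sin_mul (R : realType) (phi d : R) :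
  0 <= cos phi -> cos d - cos phi <= sin phi * sin (phi - d).
Proof.
move=> cphi.
have -> : sin phi * sin (phi - d) = cos d - cos phi * cos (phi - d).
  by have := cosB phi (phi - d); rewrite subKr => ->; ring.
by rewrite lerD2l lerN2 ler_piMr // cos_le1.
Qed.

(** * The gradient of a Rayleigh quotient *)

(** Turns directional derivatives of quadratic forms into derivatives of polynomials in [h]; the
    order of the sum in [h *: v + x] is that of the difference quotient in [derive]. *)
Lemma quadratic_line (R : realType) (n : nat) (C : 'M[R]_n) (x v : 'cV[R]_n)
    (h : R) :
  C^T = C ->
  inner (h *: v + x) (C *m (h *: v + x)) =
  (inner v (C *m v) *: 'X^2 + (2 * inner v (C *m x)) *: 'X
    + (inner x (C *m x))%:P).[h].
Proof.
move=> symC; rewrite !(hornerD, hornerZ, hornerX, hornerXn, hornerC).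
rewrite mulmxDr -scalemxAr !innerDl !innerDr !innerZl !innerZr.
rewrite (inner_symm C x v) // (innerC (C *m x)). ring.
Qed.

Lemma derive_rayleigh (R : realType) (n : nat) (M N : 'M[R]_n.+1)
    (x v : 'cV[R]_n.+1) :
  M^T = M -> N^T = N -> inner x (N *m x) != 0 ->
  'D_v (fun z => - (inner z (M *m z) / inner z (N *m z))) x =
  - 2 * (inner v (M *m x) * inner x (N *m x)
         - inner x (M *m x) * inner v (N *m x)) / inner x (N *m x) ^+ 2.
Proof.
move=> symM symN Nx.
pose poly (C : 'M[R]_n.+1) := inner v (C *m v) *: 'X^2
  + (2 * inner v (C *m x)) *: 'X + (inner x (C *m x))%:P.
have poly0 C : (poly C).[0] = inner x (C *m x).
  rewrite !(hornerD, hornerZ, hornerX, hornerXn, hornerC).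
  by rewrite expr0n !mulr0 !add0r.
have dpoly0 C : (poly C)^`().[0] = 2 * inner v (C *m x).
  rewrite !(derivD, derivZ, derivX, derivXn, derivC) addr0.
  rewrite !(hornerD, hornerZ, hornerX, hornerXn, hornerMn, hornerC).
  by rewrite /= addr0 mulr0 add0r mulr1.
have N0 : (poly N).[0] != 0 by rewrite poly0.
pose g : R -> R := fun h => - ((poly M).[h] * ((poly N).[h])^-1).
have -> : 'D_v (fun z => - (inner z (M *m z) / inner z (N *m z))) x = 'D_1 g 0.
  (* Both derivatives are limits at 0 of difference quotients, and these quotients agree for every
     [h]. *)
  rewrite /derive; set F := (fun h => _); set G := (fun h => _).
  suff -> : F = G by [].
  apply/funext => h; rewrite /F /G /=.
  rewrite /g !quadratic_line // addr0 [h *: _]mulr1 -!/(poly _).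
  by rewrite !poly0.
have dg := is_deriveN (is_deriveM (is_derive_poly (poly M) 0)
  (is_deriveV N0 (is_derive_poly (poly N) 0))).
transitivity (- ((poly M).[0] *: (- (poly N).[0] ^- 2 *: (poly N)^`().[0])
  + ((poly N).[0])^-1 *: (poly M)^`().[0])).
  exact: (@derive_val _ _ _ _ _ _ _ dg).
by rewrite !poly0 !dpoly0 /GRing.scale /=; field.
Qed.

Lemma inner_nabla_rayleigh (R : realType) (n : nat) (M N : 'M[R]_n.+1)
    (x w : 'cV[R]_n.+1) :
  M^T = M -> N^T = N -> inner x (N *m x) != 0 ->
  inner (nabla (fun z => - (inner z (M *m z) / inner z (N *m z))) x) w =
  - 2 * (inner w (M *m x) * inner x (N *m x)
         - inner x (M *m x) * inner w (N *m x)) / inner x (N *m x) ^+ 2.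
Proof.
move=> symM symN Nx.
have -> : nabla (fun z => - (inner z (M *m z) / inner z (N *m z))) x =
    (- 2 / inner x (N *m x) ^+ 2) *:
    (inner x (N *m x) *: (M *m x) - inner x (M *m x) *: (N *m x)).
  apply/colP => i; rewrite mxE derive_rayleigh // !inner_delta.
  by move: (M *m x) (N *m x) Nx => y z xz; rewrite !mxE; field.
by rewrite innerZl innerBl !innerZl !(innerC w); field.
Qed.

(** * Geometry of the sphere *)

Section Sphere.
Context {R : realType} {n : nat}.
Implicit Types x e v g : 'cV[R]_n.

Lemma tprojE x g : tproj x *m g = g - inner x g *: x.
Proof.
rewrite /tproj mulmxBl mul1mx -mulmxA [x^T *m g]mx11_scalar mul_mx_scalar.
by [].
Qed.

Lemma inner_unit_bounds x e :
  inner x x = 1 -> inner e e = 1 -> -1 <= inner x e <= 1.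
Proof.
move=> xx ee; rewrite -ler_norml -(ler_pXn2r (ltn0Sn 1)) ?nnegrE //.
rewrite expr1n real_normK ?num_real //.
by rewrite (le_trans (inner_cauchy_schwarz x e)) // xx ee mulr1.
Qed.

Lemma inner_tproj_sphlog x e g :
  x != e -> inner x x = 1 -> inner e e = 1 -> inner g x = 0 ->
  inner (tproj x *m g) (- sphlog x e) =
  - (sphdist x e / sin (sphdist x e)) * inner g e.
Proof.
move=> xe xx ee gx; rewrite /sphlog (negPf xe) innerNr innerZr !tprojE.
(* This also covers [e = - x]: the sine is then 0, division by it gives 0, and both sides vanish. *)
have -> : enorm (e - inner x e *: x) = sin (sphdist x e).
  rewrite /sphdist sin_acos ?inner_unit_bounds // /enorm.
  congr Num.sqrt; rewrite innerBl !innerBr !innerZl !innerZr xx ee (innerC e x).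
  ring.
by rewrite (innerC x g) gx scale0r subr0 innerBr innerZr gx mulr0 subr0 mulNr.
Qed.

Lemma sphdist_gt0 x e :
  x != e -> inner x x = 1 -> inner e e = 1 -> 0 < sphdist x e.
Proof.
move=> xe xx ee; have /andP[c1 c2] := inner_unit_bounds _ _ xx ee.
apply: acos_gt0; rewrite c1 /=.
have : 0 < inner (x - e) (x - e) by rewrite inner_gt0 // subr_eq0.
by rewrite innerBl !innerBr xx ee (innerC e x); lra.
Qed.

(* Triangle inequality for the angles between [x], [e], [v]: the angle of [x]
   and [v] is at most the sum of their angles with [e]. *)
Lemma spherical_triangle x e v :
  inner x x = 1 -> inner e e = 1 -> inner v v = 1 ->
  inner x e * inner v e
    - Num.sqrt (1 - inner x e ^+ 2) * Num.sqrt (1 - inner v e ^+ 2)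
  <= inner x v.
Proof.
move=> xx ee vv.
have sq_le a : inner a a = 1 -> 0 <= 1 - inner a e ^+ 2.
  by move=> aa; have := inner_cauchy_schwarz a e; rewrite aa ee; lra.
have := inner_cauchy_schwarz (x - inner x e *: e) (v - inner v e *: e).
rewrite !innerBl !innerBr !innerZl !innerZr xx ee vv !(innerC e) => CS.
have {}CS : (inner x v - inner x e * inner v e) ^+ 2 <=
    (1 - inner x e ^+ 2) * (1 - inner v e ^+ 2).
  by move: CS; congr (_ <= _); ring.
have : `|inner x v - inner x e * inner v e| <=
    Num.sqrt ((1 - inner x e ^+ 2) * (1 - inner v e ^+ 2)).
  by rewrite -sqrtr_sqr ler_wsqrtr.
by rewrite sqrtrM ?sq_le // ler_norml => /andP[]; lra.
Qed.

End Sphere.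

(** * The spectral gap *)

(* In an orthonormal eigenbasis, a vector orthogonal to [u] has no component
   along the only coordinate whose eigenvalue is [lam 0]. *)
Lemma spectral_gap (R : realType) (n : nat) (A : 'M[R]_n.+2)
    (lam : 'I_n.+2 -> R) (u w : 'cV[R]_n.+2) :
  A^T = A -> eigenvalues A lam -> lam 0 < lam 1 ->
  (forall i j : 'I_n.+2, (i <= j)%N -> lam i <= lam j) ->
  u != 0 -> A *m u = lam 0 *: u -> inner u w = 0 ->
  lam 1 * inner w w <= inner w (A *m w).
Proof.
move=> symA eigA lam01 lam_sorted u0 Au uw.
have [P PP PA] := symmetric_diagonalization _ _ _ _ symA eigA.
have PP' := mulmx1C PP.
have defA : A = P^T *m diag_mx (\row_i lam i) *m P.
  by rewrite -PA !mulmxA PP' mul1mx -mulmxA PP' mulmx1.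
have innerP a b : inner (P *m a) (P *m b) = inner a b.
  by rewrite inner_mull mulmxA PP' mul1mx.
have lam1_le i : i != 0 -> lam 1 <= lam i.
  by move=> i0; apply: lam_sorted; rewrite lt0n.
have Pu_eq0 i : i != 0 -> (P *m u) i 0 = 0.
  move=> i0; have : P *m (A *m u) = diag_mx (\row_i lam i) *m (P *m u).
    by rewrite defA !mulmxA PP mul1mx.
  rewrite Au -scalemxAr mul_diag_mx => /matrixP/(_ i 0); rewrite !mxE => /eqP.
  rewrite -subr_eq0 -mulrBl mulf_eq0 subr_eq0 => /orP[|/eqP//].
  by rewrite lt_eqF // (lt_le_trans lam01) ?lam1_le.
have Pw0 : (P *m w) 0 0 = 0.
  have Pu0 : (P *m u) 0 0 != 0.
    apply: contraNneq u0 => Pu0; rewrite -[u]mul1mx -PP' -mulmxA.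
    suff -> : P *m u = 0 by rewrite mulmx0.
    by apply/colP => i; rewrite [RHS]mxE; have [->|/Pu_eq0] := eqVneq i 0.
  move: uw; rewrite -innerP innerE (bigD1 0) //= big1 ?addr0 => [|i /Pu_eq0 ->].
    by move/eqP; rewrite mulf_eq0 (negPf Pu0) => /eqP.
  by rewrite mul0r.
rewrite defA -!mulmxA -inner_mull -(innerP w w) !innerE mulr_sumr.
move: (P *m w) Pw0 => y y0; apply: ler_sum => i _; rewrite mul_diag_mx !mxE.
have [->|/lam1_le lam_i] := eqVneq i 0; first by rewrite y0 !mulr0.
by rewrite [leRHS]mulrCA ler_wpM2r // -expr2 sqr_ge0.
Qed.

(** Let [c] be the cosine of the angle of [y] and [u] in the [A]-inner product. The spectral gap
    bounds the right side below by the gap times 1 - c^2, which is at least 1 - c as 0 <= c <= 1;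
    the comparison of [B] with [A] then passes from [c] to the cosine in the [B]-inner product. *)
Lemma eigenvector_defect_bound (R : realType) (n : nat) (A B : 'M[R]_n.+2)
    (lam : 'I_n.+2 -> R) (u y : 'cV[R]_n.+2) (nu : R) :
  spd A -> spd B -> eigenvalues A lam -> 0 < lam 0 -> lam 0 < lam 1 ->
  (forall i j : 'I_n.+2, (i <= j)%N -> lam i <= lam j) ->
  u != 0 -> A *m u = lam 0 *: u -> 0 < nu ->
  (forall z, nu * inner z (B *m z) <= inner z (A *m z)) ->
  inner y (B *m y) = 1 -> 0 <= inner u y ->
  nu * ((lam 0)^-1 - (lam 1)^-1) * normC B u
    / (Num.sqrt (inner y (A *m y)) * normC A u)
    * (1 - inner y (B *m u) / normC B u)
  <= (lam 0)^-1 - inner y y / inner y (A *m y).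
Proof.
move=> [symA posA] [symB posB] eigA lam0 lam01 lam_sorted u0 Au nu0 nuAB yBy uy.
have y0 : y != 0.
  apply/eqP => y0; move: yBy; rewrite y0 mulmx0 innerv0 => /esym/eqP.
  by rewrite oner_eq0.
have uu := inner_gt0 _ u0; have q0 := posA _ y0.
have posA' z : 0 <= inner z (A *m z).
  by have [->|/posA/ltW//] := eqVneq z 0; rewrite mulmx0 innerv0.
have uAy : inner u (A *m y) = lam 0 * inner u y.
  by rewrite inner_symm // Au innerZl.
have uAu : inner u (A *m u) = lam 0 * inner u u by rewrite Au innerZr.
have na2 : normC A u ^+ 2 = lam 0 * inner u u.
  by rewrite sqr_sqrtr ?posA' // uAu.
have nb2 : normC B u ^+ 2 = inner u (B *m u).
  by rewrite sqr_sqrtr // ltW // posB.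
have nb0 : 0 < normC B u by rewrite sqrtr_gt0 posB.
have na0 : 0 < normC A u by rewrite sqrtr_gt0 posA.
set q := inner y (A *m y) in q0 *; set p := inner y y.
set sq := Num.sqrt q.
have sq0 : 0 < sq by rewrite sqrtr_gt0.
have sq2 : sq ^+ 2 = q by rewrite sqr_sqrtr // ltW.
set na := normC A u in na2 na0 *; set nb := normC B u in nb2 nb0 *.
set r := inner y (B *m u); pose c := lam 0 * inner u y / (sq * na).
have c0 : 0 <= c by rewrite !(mulr_ge0, invr_ge0) // ltW.
have cosA : 0 <= 1 - c /\ nu * nb / (sq * na) * (1 - r / nb) <= 1 - c.
  (* [inner z (A *m z) = 2 * (1 - c)] is compared with [nu * inner z (B *m z)],
     whose square terms are bounded below by AM-GM. *)
  pose z := sq^-1 *: y - na^-1 *: u.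
  have zAz : inner z (A *m z) = 2 * (1 - c).
    rewrite mulmxBr -!scalemxAr !innerBl !innerBr !innerZl !innerZr uAy uAu.
    rewrite (inner_symm A y u) // (innerC _ u) uAy -/q -sq2 /c.
    rewrite -na2; field.
    by rewrite !gt_eqF.
  have zBz : inner z (B *m z) = sq ^- 2 + nb ^+ 2 / na ^+ 2 - 2 * r / (sq * na).
    rewrite mulmxBr -!scalemxAr !innerBl !innerBr !innerZl !innerZr yBy -nb2 -/r.
    rewrite (inner_symm B u) // (innerC _ y) -/r; field.
    by rewrite !gt_eqF.
  split; first by have := posA' z; rewrite zAz; lra.
  have := nuAB z; rewrite zAz zBz => le_z.
  have : 0 <= nu * (sq^-1 - nb / na) ^+ 2 by rewrite mulr_ge0 ?sqr_ge0 ?ltW.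
  have -> : nu * (sq^-1 - nb / na) ^+ 2 =
      nu * (sq ^- 2 + nb ^+ 2 / na ^+ 2 - 2 * r / (sq * na))
      - 2 * (nu * nb / (sq * na) * (1 - r / nb)).
    by field; rewrite !gt_eqF.
  lra.
have c2 : c ^+ 2 = lam 0 * inner u y ^+ 2 / (q * inner u u).
  rewrite /c expr_div_n !exprMn sq2 na2; field.
  by rewrite !gt_eqF.
have defect : ((lam 0)^-1 - (lam 1)^-1) * (1 - c ^+ 2) <= (lam 0)^-1 - p / q.
  (* The component of [y] orthogonal to [u]. As [u] is an eigenvector, it is [A]-orthogonal to [u]
     too, so both quadratic forms split. *)
  pose w := y - (inner u y / inner u u) *: u.
  have uw : inner u w = 0 by rewrite innerBr innerZr divfK ?subrr // gt_eqF.
  have := spectral_gap _ _ _ _ _ _ symA eigA lam01 lam_sorted u0 Au uw.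
  have -> : inner w w = p - inner u y ^+ 2 / inner u u.
    rewrite !innerBl !innerBr !innerZl !innerZr (innerC y u) -/p; field.
    by rewrite gt_eqF.
  have -> : inner w (A *m w) = q - lam 0 * inner u y ^+ 2 / inner u u.
    rewrite mulmxBr -!scalemxAr !innerBl !innerBr !innerZl !innerZr uAy uAu Au.
    rewrite innerZr (innerC y u) -/q; field.
    by rewrite gt_eqF.
  have lam1 : 0 < lam 1 by apply: lt_trans lam01.
  rewrite mulrC -ler_pdivlMr // => gap.
  (* After multiplication by [q] the claim is exactly [gap]. *)
  rewrite -(ler_pM2l q0) -subr_ge0.
  have -> : q * ((lam 0)^-1 - p / q)
        - q * (((lam 0)^-1 - (lam 1)^-1) * (1 - c ^+ 2))
      = (q - lam 0 * inner u y ^+ 2 / inner u u) / lam 1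
        - (p - inner u y ^+ 2 / inner u u).
    by rewrite c2; field; rewrite !gt_eqF.
  by rewrite subr_ge0.
apply: le_trans defect.
have gap0 : 0 <= (lam 0)^-1 - (lam 1)^-1.
  by rewrite subr_ge0 lef_pV2 ?posrE ?ltW // (lt_trans lam0).
rewrite [nu * _]mulrC -!mulrA ler_wpM2l // !mulrA.
case: cosA => c1 /le_trans; apply.
(* This is 1 - c <= 1 - c^2. *)
have : 0 <= (1 - c) * c by rewrite mulr_ge0.
lra.
Qed.

(** * The gradient inequality on the sphere *)

Theorem proposition10 (R : realType) (n : nat) (A B : 'M[R]_n.+2)
    (lam : 'I_n.+2 -> R) (u : 'cV[R]_n.+2) (numin numax : R)
    (hA : spd A) (hB : spd B)
    (hlam : eigenvalues A lam)
    (hlam1 : 0 < lam 0) (hlam12 : lam 0 < lam 1)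
    (hlam_sorted : forall i j : 'I_n.+2, (i <= j)%N -> lam i <= lam j)
    (hu : u != 0) (hAu : A *m u = lam 0 *: u)
    (hnumin : 0 < numin) (hnu : numin <= numax)
    (hAB : forall y : 'cV[R]_n.+2,
       numin * inner y (B *m y) <= inner y (A *m y)
         <= numax * inner y (B *m y))
    (x : 'cV[R]_n.+2) (hx : sphere x)
    (hdist : sphdist x (xstar B u) < distortion B u) :
  cost A B x - cost A B (xstar B u)
  <= 1 / a_coef A B (lam 0) u x
       * inner (rgrad (cost A B) x) (- sphlog x (xstar B u))
     - mu_coef A B numin (lam 0) (lam 1) u x / 2
       * sphdist x (xstar B u) ^+ 2.
Proof.
have [[symS posS] SS] := mxsqrtP _ hB; have [[symT _] TT] := mxsqrtP _ hA.
have [symA posA] := hA; have [symB posB] := hB.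
have unitS : mxsqrt B \in unitmx by apply: spd_unit.
rewrite /sphere /= in hx.
rewrite /mu_coef /a_coef /rgrad /cost /mxisqrt.
set S := mxsqrt B in symS posS SS unitS *; set T := mxsqrt A in symT TT *.
pose y := invmx S *m x.
have Sy : x = S *m y by rewrite mulKVmx.
have symS' : (invmx S)^T = invmx S by rewrite trmx_inv symS.
have invB : invmx B = invmx S *m invmx S.
  by rewrite -{1}SS; apply: invrM.
have symB' : (invmx B)^T = invmx B by rewrite trmx_inv symB.
have symM : (invmx S *m A *m invmx S)^T = invmx S *m A *m invmx S.
  by rewrite !trmx_mul symS' symA mulmxA.
(* The substitution x = S y turns the Euclidean product into the [B]-product, the numerator of
   [cost] into the Euclidean product, and its denominator into the [A]-product. *)
have innerS a b : inner (S *m a) (S *m b) = inner a (B *m b).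
  by rewrite inner_mull symS mulmxA SS.
have innerSB a b : inner (S *m a) (invmx B *m (S *m b)) = inner a b.
  by rewrite invB -mulmxA mulKmx // inner_mull symS mulKVmx.
have innerSM a b :
    inner (S *m a) (invmx S *m A *m invmx S *m (S *m b)) = inner a (A *m b).
  by rewrite -!mulmxA mulKmx // inner_mull symS mulKVmx.
have uu := inner_gt0 _ hu; have uBu := posB _ hu.
set e := xstar B u; set nb := normC B u.
have nb0 : 0 < nb by rewrite sqrtr_gt0.
have nb2 : nb ^+ 2 = inner u (B *m u) by rewrite sqr_sqrtr // ltW.
have eE : e = S *m (nb^-1 *: u).
  by rewrite -scalemxAr /e /xstar /enorm innerS.
have xx : inner x x = 1 by rewrite -sqr_enorm hx expr1n.
have ee : inner e e = 1.
  by rewrite eE innerS -scalemxAr innerZl innerZr -nb2; field; rewrite gt_eqF.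
have yBy : inner y (B *m y) = 1 by rewrite -innerS -Sy.
have y0 : y != 0.
  apply/eqP => y0; move: yBy; rewrite y0 mulmx0 innerv0 => /esym/eqP.
  by rewrite oner_eq0.
set q := inner y (A *m y); have q0 : 0 < q := posA _ y0.
set p := inner y y.
have -> : enorm (T *m invmx S *m x) = Num.sqrt q.
  by rewrite /enorm Sy -mulmxA mulKmx // inner_mull symT mulmxA TT.
set s := inner u y.
have xBx : inner x (invmx B *m x) = p by rewrite {1 2}Sy innerSB.
have xMx : inner x (invmx S *m A *m invmx S *m x) = q.
  by rewrite {1 2}Sy innerSM.
have eBx : inner e (invmx B *m x) = s / nb.
  by rewrite eE Sy innerSB innerZl mulrC.
have eMx : inner e (invmx S *m A *m invmx S *m x) = lam 0 * s / nb.
  by rewrite eE Sy innerSM innerZl inner_symm // hAu innerZl mulrC.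
have eBe : inner e (invmx B *m e) = inner u u / nb ^+ 2.
  by rewrite eE innerSB innerZl innerZr; field; rewrite gt_eqF.
have eMe : inner e (invmx S *m A *m invmx S *m e) = lam 0 * inner u u / nb ^+ 2.
  rewrite eE innerSM -scalemxAr innerZl innerZr hAu innerZr; field.
  by rewrite gt_eqF.
rewrite xBx xMx eBe eMe.
(* The value at [e] is -1 / lambda_1, so [Delta] below stands for f(x) - f_*. *)
have -> : - (p / q) - - (inner u u / nb ^+ 2 / (lam 0 * inner u u / nb ^+ 2))
    = (lam 0)^-1 - p / q by field; rewrite !gt_eqF.
set Delta := _ - p / q.
set d := sphdist x e in hdist *; set phi := distortion B u in hdist *.
set nbi := normC (invmx B) u.
have uB'u : inner u (invmx B *m u) = inner (invmx S *m u) (invmx S *m u).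
  by rewrite invB -mulmxA inner_symm.
have Su0 : 0 < inner (invmx S *m u) (invmx S *m u).
  apply: inner_gt0; apply: contraNneq hu => Su0.
  by rewrite -(mulKVmx unitS u) Su0 mulmx0.
have nbi2 : nbi ^+ 2 = inner (invmx S *m u) (invmx S *m u).
  by rewrite -uB'u sqr_sqrtr // uB'u ltW.
have nbi0 : 0 < nbi by rewrite sqrtr_gt0 uB'u.
(* The auxiliary unit vector along B^{-1/2} u_*: its inner product with [e] is sin phi, and with [x]
   it is [s / nbi]. *)
pose v := nbi^-1 *: (invmx S *m u).
have vv : inner v v = 1.
  by rewrite innerZl innerZr -nbi2; field; rewrite gt_eqF.
set sigma := inner u u / (nb * nbi).
have ve : inner v e = sigma.
  rewrite /v eE innerZl inner_mull symS' mulKmx // innerZr /sigma; field.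
  by rewrite !gt_eqF.
have xv : inner x v = s / nbi.
  by rewrite innerC /v innerZl inner_mull symS' -/y mulrC.
have sigma0 : 0 < sigma by rewrite divr_gt0 ?mulr_gt0.
have sigma1 : -1 <= sigma <= 1 by rewrite -ve inner_unit_bounds.
have phiE : phi = asin sigma by rewrite /phi /distortion sqr_enorm.
have sin_phi : sin phi = sigma by rewrite phiE asinK ?in_itv.
have cos_phi : cos phi = Num.sqrt (1 - sigma ^+ 2) by rewrite phiE cos_asin.
have phi_le : phi <= pi / 2 by rewrite phiE asin_lepi2.
have c1 := inner_unit_bounds _ _ xx ee.
have d0 : 0 <= d by rewrite acos_ge0.
have cos_d : cos d = inner x e by rewrite acosK ?in_itv.
have sin_d : sin d = Num.sqrt (1 - inner x e ^+ 2) by rewrite sin_acos.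
have cos_lt : cos phi < cos d.
  rewrite ltr_cos ?in_itv /= ?d0 ?(le_trans d0 (ltW hdist)) //=;
    have := @pi_gt0 R; lra.
(* By the addition formula, sin (phi - d) is the left side of [spherical_triangle] for [x], [e],
   [v]. *)
have sin_le : sin (phi - d) <= s / nbi.
  rewrite sinB sin_phi cos_phi sin_d cos_d mulrC [Num.sqrt _ * _]mulrC -xv -ve.
  exact: spherical_triangle.
have sin_gt0 : 0 < sin (phi - d) by apply: sin_gt0_pi; have := @pi_gt0 R; lra.
have s0 : 0 < s.
  by have := lt_le_trans sin_gt0 sin_le; rewrite pmulr_lgt0 ?invr_gt0.
have DeltaE : numin * ((lam 0)^-1 - (lam 1)^-1) * nb / (Num.sqrt q * normC A u)
    * (1 - cos d) <= Delta.
  have -> : cos d = inner y (B *m u) / nb.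
    by rewrite cos_d eE Sy innerS -scalemxAr innerZr mulrC.
  apply: eigenvector_defect_bound => //; last exact: ltW.
  by move=> z; have /andP[] := hAB z.
have na0 : 0 < normC A u by rewrite sqrtr_gt0 posA.
have lam1_gt0 := lt_trans hlam1 hlam12.
have gap0 : 0 <= (lam 0)^-1 - (lam 1)^-1.
  by rewrite subr_ge0 lef_pV2 ?posrE ?ltW.
set K := numin * _ * nb / (Num.sqrt q * normC A u) in DeltaE.
have K0 : 0 <= K by rewrite divr_ge0 ?mulr_ge0 ?sqrtr_ge0 // ltW.
have sq0 : 0 < Num.sqrt q by rewrite sqrtr_gt0.
set mu := _ / (pi ^+ 2 * _ * _).
(* Here mu = 8 K / pi^2, so half of it matches the 4 / pi^2 of [cos_quadratic_bound], which applies
   since d < phi <= pi / 2. *)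
have le_mu : mu / 2 * d ^+ 2 <= Delta.
  apply: le_trans DeltaE.
  have -> : mu / 2 * d ^+ 2 = K * (4 / pi ^+ 2 * d ^+ 2).
    rewrite /mu /K; move: (@pi R) (@pi_gt0 R) => P P0; field.
    by rewrite !gt_eqF.
  by rewrite ler_wpM2l // cos_quadratic_bound // (le_trans (ltW hdist)).
(* At x = x_* every term is 0; elsewhere sin d is positive and may be divided by. *)
have [xe|xe] := eqVneq x e.
  have -> : d = 0 by rewrite /d xe /sphdist ee acos1.
  have -> : Delta = 0.
    by rewrite /Delta -xBx -xMx xe eBe eMe; field; rewrite !gt_eqF.
  by rewrite /sphlog xe eqxx oppr0 innerv0 expr0n !mulr0 subr0.
have d_gt0 : 0 < d by apply: sphdist_gt0.
have sind0 : 0 < sin d by apply: sin_gt0_pi; have := @pi_gt0 R; lra.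
have nablaE w := inner_nabla_rayleigh _ _ _ _ x w symB' symM.
rewrite xBx xMx in nablaE.
(* The side condition says that the Euclidean gradient is orthogonal to [x]; it holds because the
   cost is homogeneous of degree 0. *)
rewrite inner_tproj_sphlog //; last first.
  by rewrite nablaE ?gt_eqF // xBx xMx; ring.
rewrite nablaE ?gt_eqF // eBx eMx -/d sqr_enorm.
rewrite [Num.sqrt q ^+ 2]sqr_sqrtr ?(ltW q0) //.
set grad := (X in _ <= X - _).
(* One [Delta] is the left side of the goal, the other absorbs the [mu] term by [le_mu]. *)
suff : 2 * Delta <= grad by lra.
have Delta0 : 0 <= Delta.
  by apply: le_trans DeltaE; rewrite mulr_ge0 // subr_ge0 cos_le1.
(* Besides 2 and [Delta], two factors remain, each at least 1: the first by sin d <= d, the second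
   by cos d - cos phi <= sin phi sin (phi - d) together with [sin_le]. *)
have -> : grad =
    2 * (d / sin d * (sigma * (s / nbi) / (cos d - cos phi))) * Delta.
  rewrite /grad /Delta /sigma -/nbi; field.
  by rewrite !gt_eqF // subr_gt0.
rewrite ler_wpM2r // -[leLHS]mulr1 ler_wpM2l // mulr_ege1 //.
  by rewrite ler_pdivlMr // mul1r sin_le_id.
rewrite ler_pdivlMr ?subr_gt0 // mul1r -sin_phi.
apply: le_trans (cos_sub_le_sin_mul _ phi d _) _.
  by rewrite cos_phi sqrtr_ge0.
by rewrite ler_wpM2l // sin_phi ltW.
Qed.
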